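(* Let $w_1,\dots,w_n,D$ be positive integers and let $\Delta\subset SL_n(\mathbb C)$ be a finite subgroup, commuting with the $\mathbb C^*$-action on $\mathbb C^n$ with weights $w_1,\dots,w_n$, and containing in its center the exponential grading operator $J_W=\mathrm{diag}(e^{2\pi\sqrt{-1}w_1/D},\dots,e^{2\pi\sqrt{-1}w_n/D})$. Let $y=e^{2\pi\sqrt{-1}z}$ (with $y^c=e^{2\pi\sqrt{-1}cz}$). Then the elliptic genus of the Landau-Ginzburg phase with weights $w_i$ and degree $D$ orbifoldized by $\Delta$ specializes for $q\to0$ to $$\sum_{\{h\}\in \mathrm{Conj}(\Delta)}y^{\sum_{\lambda,\,\lambda(h)\ne0}(-\frac12+\lambda(h))}\ \frac1{|C(h)|}\sum_{g\in C(h)}\ \prod_{\lambda,\,\lambda(h)=0}y^{-\frac12}\,\frac{1-y^{1-\frac{w_\lambda}D}e^{2\pi\sqrt{-1}\lambda(g)}}{1-y^{-\frac{w_\lambda}D}e^{2\pi\sqrt{-1}\lambda(g)}},$$ where $\mathrm{Conj}(\Delta)$ is the set of conjugacy classes of $\Delta$ and $C(h)$ is the centralizer of $h$ in $\Delta$. If $\Delta$ is abelian, this equals $$\frac1{|\Delta|}\sum_{h\in\Delta}y^{\sum_{\lambda,\,\lambda(h)\ne0}(-\frac12+\lambda(h))}\sum_{g\in\Delta}\ \prod_{\lambda,\,\lambda(h)=0}\frac{y^{\frac12}-y^{\frac{w_\lambda}D-\frac12}e^{2\pi\sqrt{-1}\lambda(g)}}{1-y^{\frac{w_\lambda}D}e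^{2\pi\sqrt{-1}\lambda(g)}}.$$
   Context: $\tau$ is in the upper half plane, $q=e^{2\pi\sqrt{-1}\tau}$, $z\in\mathbb C$, and $\theta(z,\tau)=q^{1/8}(2\sin\pi z)\prod_{l\ge1}(1-q^l)\prod_{l\ge1}(1-q^le^{2\pi\sqrt{-1}z})(1-q^le^{-2\pi\sqrt{-1}z})$. The limit $q\to0$ means $\tau\to\sqrt{-1}\infty$ with $z$ fixed and generic. For commuting $g,h\in\Delta$, decompose $\mathbb C^n$ into a direct sum of lines which are common eigenspaces of $g$, $h$ and the weighted $\mathbb C^*$-action $z_i\mapsto\lambda^{w_i}z_i$. The index $\lambda$ runs over these $n$ lines; $g$ and $h$ act on the line $\lambda$ by $e^{2\pi\sqrt{-1}\lambda(g)}$ and $e^{2\pi\sqrt{-1}\lambda(h)}$, with $\lambda(g),\lambda(h)\in[0,1)$, and $w_\lambda\in\{w_1,\dots,w_n\}$ is the $\mathbb C^*$-weight of the line. The LG phase with weights $w_i$ and degree $D$ is the GIT quotient $\mathbb C^n/\mu_D$ (with $\mu_D$ generated by $J_W$) of the locus $s\neq0$ for the action $\lambda(s,z_1,\dots,z_n)=(\lambda^{-D}s,\lambda^{w_1}z_1,\dots,\lambda^{w_n}z_n)$ on $\mathbb C\times\mathbb C^n$. Its elliptic genus orbifoldized by $\Delta$ is $$\frac1{|\Delta|}\sum_{g,h\in\Delta,\ gh=hg}\ \prod_\lambda\frac{\theta\big((\frac{w_\lambda}D-1)z+\lambda(g)-\lambda(h)\tau,\tau\big)}{\theta\big(\frac{w_\lambda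 z}D+\lambda(g)-\lambda(h)\tau,\tau\big)}\,e^{2\pi\sqrt{-1}\lambda(h)z}.$$ *)

(* Defs.v *)
From mathcomp Require Export all_boot all_order all_algebra all_fingroup all_solvable.
From mathcomp Require Export all_field all_character.
From mathcomp Require Export all_classical all_reals all_analysis.
From mathcomp Require Export complex.
From mathcomp Require Import separable cyclotomic.

Set Implicit Arguments.
Unset Strict Implicit.
Unset Printing Implicit Defensive.

Import Order.TTheory GRing.Theory Num.Theory.
Import numFieldNormedType.Exports.

Local Open Scope classical_set_scope.
Local Open Scope ring_scope.
Local Open Scope complex_scope.

Section ComplexFunctions.
Context {R : realType}.
Implicit Types z tau c : R[i].

Definition cexp z : R[i] :=
  (expR (complex.Re z))%:C * (cos (complex.Im z) +i* sin (complex.Im z)).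

Definition e2pi z : R[i] := cexp (2 * pi%:C * 'i * z).

Definition csin z : R[i] := (cexp ('i * z) - cexp (- ('i * z))) / (2 * 'i).

(* [ypow z c] is y^c, where y = e^(2 pi i z). *)
Definition ypow z c : R[i] := e2pi (c * z).

(* With q = e^(2 pi i tau), the factor q^(1/8) is e^(2 pi i tau / 8).
   [R[i]^o] is R[i] with the topology given by its norm. *)
Definition theta z tau : R[i] :=
  let q := e2pi tau in
  e2pi (tau / 8) * (2 * csin (pi%:C * z)) *
  lim ((\prod_(1 <= l < N) (1 - q ^+ l) : R[i]^o) @[N --> \oo]) *
  lim ((\prod_(1 <= l < N)
          ((1 - q ^+ l * e2pi z) * (1 - q ^+ l * e2pi (- z))) : R[i]^o)
         @[N --> \oo]).

(* The neighbourhoods of i oo : since |e^(2 pi i tau)| = e^(- 2 pi Im tau),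
   tau tends to i oo along this filter exactly when q tends to 0. *)
Definition ioo : set_system R[i] :=
  [set A | exists M : R, forall tau, M < complex.Im tau -> A tau].

#[global] Instance ioo_proper_filter : ProperFilter ioo.
Proof.
split.
  by move=> [M /(_ (0 +i* (M + 1)))]; apply; rewrite /= ltrDl.
split=> [|A B [M HM] [N HN]|A B AB [M HM]].
- by exists 0.
- exists (Num.max M N) => tau; rewrite gt_max => /andP[? ?].
  by split; [apply: HM|apply: HN].
- by exists M => tau /HM /AB.
Qed.

End ComplexFunctions.

(* A splitting of C^n into n lines, spanned by the columns of [line_basis];
   on the k-th line [g] acts by e^(2 pi i line_fst k), [h] acts by
   e^(2 pi i line_snd k), and t in C^* acts by t ^+ line_weight k.
   [common_eigenlines] below forces every line_weight to be one of the w j. *)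
Record eigenlines (R : realType) (n : nat) := Eigenlines {
  line_basis : 'M[R[i]]_n;
  line_fst : 'I_n -> R;
  line_snd : 'I_n -> R;
  line_weight : 'I_n -> nat }.

(* A finite subgroup of GL_n(C) is given as a finite group [G] together with a
   faithful representation; matrices act on column vectors. *)
Section EllipticGenus.
Context {R : realType} {gT : finGroupType} {n : nat}.
Variables (G : {group gT}) (rG : mx_representation R[i] G n).
Variables (w : 'I_n -> nat) (D : nat).

Definition torus (t : R[i]) : 'M[R[i]]_n := diag_mx (\row_j t ^+ w j).

Definition grading_operator : 'M[R[i]]_n :=
  diag_mx (\row_j e2pi ((w j)%:R / D%:R)).

Definition common_eigenlines (g h : gT) (L : eigenlines R n) : Prop :=
  line_basis L \in unitmx /\
  forall k, let v := col k (line_basis L) in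
    [/\ 0 <= line_fst L k < 1, rG g *m v = e2pi (line_fst L k)%:C *: v,
        0 <= line_snd L k < 1, rG h *m v = e2pi (line_snd L k)%:C *: v
      & forall t : R[i], t != 0 -> torus t *m v = t ^+ line_weight L k *: v].

Definition LG_elliptic_genus (L : gT -> gT -> eigenlines R n) (z tau : R[i])
    : R[i] :=
  #|G|%:R^-1 * \sum_(g in G) \sum_(h in G | (g * h == h * g)%g) \prod_(k < n)
    let a := (line_fst (L g h) k)%:C in
    let b := (line_snd (L g h) k)%:C in
    let wk : R[i] := (line_weight (L g h) k)%:R in
    theta ((wk / D%:R - 1) * z + a - b * tau) tau /
    theta (wk * z / D%:R + a - b * tau) tau * e2pi (b * z).

(* The values of z at which no denominator of the q -> 0 limit vanishes: only
   the discrete set of z with w_lambda z / D + lambda(g) in Z is excluded. *)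
Definition generic_point (L : gT -> gT -> eigenlines R n) (z : R[i]) : Prop :=
  forall g h k (m : int), g \in G -> h \in G -> commute g h ->
    line_snd (L g h) k = 0 ->
    (line_weight (L g h) k)%:R * z / D%:R + (line_fst (L g h) k)%:C != m%:~R.

End EllipticGenus.

Section Existence.
Context {R : realType}.

Lemma e2pi_real (a : R) :
  e2pi a%:C = cos (pi *+ 2 * a) +i* sin (pi *+ 2 * a).
Proof.
have E : 2 * pi%:C * 'i * a%:C = 0 +i* (pi *+ 2 * a) :> R[i].
  move: pi => p; apply/eqP; rewrite eq_complex -mulr_natl; simpc => /=.
  by rewrite mulrDl mul1r mulr2n.
by rewrite /e2pi E /cexp /= expR0; simpc.
Qed.

Lemma e2pi_onto_roots (m : nat) (c : R[i]) : (0 < m)%N -> c ^+ m = 1 ->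
  exists a : R, 0 <= a < 1 /\ c = e2pi a%:C.
Proof.
move=> m0 cm1.
have : `|c| = 1.
  by apply: (@pexpIrn _ m) => //; rewrite ?nnegrE// -normrX cm1 normr1 expr1n.
case: c {cm1} => x y; rewrite normc_def => -[] /(congr1 (fun u => u ^+ 2)).
rewrite sqr_sqrtr ?addr_ge0 ?sqr_ge0// expr1n /= => xy1.
have x1 : -1 <= x <= 1.
  rewrite -ler_norml -(@ler_pXn2r _ 2) ?nnegrE// expr1n real_normK ?num_real//.
  by rewrite -xy1 lerDl sqr_ge0.
have [a0 api] := (acos_ge0 x1, acos_lepi x1).
have cosa : cos (acos x) = x by rewrite acosK// in_itv.
have p0 := @pi_gt0 R.
have pp0 : 0 < pi *+ 2 :> R by rewrite mulrn_wgt0.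
have sina : sin (acos x) = `|y|.
  by rewrite sin_acos// -xy1 addrAC subrr add0r sqrtr_sqr.
have K (b : R) : 0 <= b < pi *+ 2 -> cos b = x -> sin b = y ->
    exists a : R, 0 <= a < 1 /\ x +i* y = e2pi a%:C.
  move=> /andP[b0 b1] cb sb; exists (b / (pi *+ 2)); split.
    by rewrite divr_ge0 ?(ltW pp0)//= ltr_pdivrMr// mul1r.
  by rewrite e2pi_real mulrC divfK ?gt_eqF// cb sb.
have [y0|y0] := leP 0 y.
  apply: (K (acos x)) => //; last by rewrite sina ger0_norm.
  by rewrite a0 (le_lt_trans api)// mulr2n ltrDl.
apply: (K (pi *+ 2 - acos x)).
- rewrite subr_ge0 (le_trans api) ?mulr2n ?lerDl ?ltW//=.
  rewrite gtrBl lt_neqAle a0 andbT eq_sym; apply: contraTneq y0 => ax0.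
  by move: sina; rewrite ax0 sin0 => /esym/normr0_eq0 ->; rewrite ltxx.
- by rewrite addrC cosD2pi cosN.
- by rewrite addrC sinD2pi sinN sina ltr0_norm// opprK.
Qed.

Lemma finite_order_diagonalizable n m (A : 'M[R[i]]_n.+1) :
  (0 < m)%N -> A ^+ m = 1 -> diagonalizable A.
Proof.
move=> m0 Am; apply/diagonalizableP.
have [rs Drs] := closed_field_poly_normal ('X^m - 1 : {poly R[i]}).
have lc : lead_coef ('X^m - 1 : {poly R[i]}) = 1.
  exact: (monicP (monicXnsubC 1 m0)).
exists rs.
  rewrite -separable_prod_XsubC -[X in separable_poly X]scale1r -lc -Drs.
  by rewrite separable_Xn_sub_1// pnatr_eq0 -lt0n.
rewrite -[X in Pdiv.Field.dvdp _ X]scale1r -lc -Drs; apply: mxminpoly_min.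
by rewrite rmorphB /= rmorphXn /= horner_mx_X rmorph1 Am subrr.
Qed.

(* Every commuting pair does admit a splitting as in [common_eigenlines]. *)
Lemma common_eigenlines_exist (gT : finGroupType) (n : nat)
    (G : {group gT}) (rG : mx_representation R[i] G n) (w : 'I_n -> nat) g h :
    (forall x (t : R[i]), x \in G -> t != 0 ->
       rG x *m torus w t = torus w t *m rG x) ->
    g \in G -> h \in G -> commute g h ->
  exists L, common_eigenlines rG w g h L.
Proof.
case: n rG w => [|n] rG w rGw gG hG cgh.
  by exists (Eigenlines 1%:M (fun=> 0) (fun=> 0) (fun=> 0%N)); split=> [|[]//];
     rewrite unitmx1.
have finX x : x \in G -> rG x ^+ #[x]%g = 1.
  by move=> xG; rewrite -repr_mxX// expg_order repr_mx1.
have two0 : 2 != 0 :> R[i] by rewrite pnatr_eq0.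
have /codiagonalizableP [P Pu] : let As := [:: rG g; rG h; torus w 2] in
    {in As &, forall A B, comm_mx A B} /\ {in As, forall A, diagonalizable A}.
  split.
    have cgh' : comm_mx (rG g) (rG h) by rewrite /comm_mx -!repr_mxM// cgh.
    move=> A B; rewrite !inE => /or3P[]/eqP-> /or3P[]/eqP-> //;
      rewrite /comm_mx ?rGw//.
  move=> A; rewrite !inE => /or3P[]/eqP->; last exact: diagonalizable_diag.
    exact: (finite_order_diagonalizable (order_gt0 g) (finX _ gG)).
  exact: (finite_order_diagonalizable (order_gt0 h) (finX _ hG)).
move=> /allP DP.
have [Dg Dh Dt] : [/\ diagonalizable_for P (rG g), diagonalizable_for P (rG h)
    & diagonalizable_for P (torus w 2)].
  by split; apply: DP; rewrite !inE eqxx ?orbT.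
have eig A : diagonalizable_for P A -> exists d : 'I_n.+1 -> R[i],
    forall k, A *m col k (invmx P) = d k *: col k (invmx P).
  move=> /(diagonalizable_forLR Pu)[d ->]; rewrite mxpoly.conjVmx//.
  exists (fun k => d 0 k) => k.
  rewrite -!mulmxA colE (mulmxA P) mulmxV// mul1mx mul_diag_mx scalemxAr.
  congr (_ *m _); apply/matrixP => i j; rewrite !mxE.
  by case: eqVneq => [->//|]; rewrite !mulr0.
have colN0 k : col k (invmx P) != 0.
  apply/eqP => /(congr1 (mulmx P)); rewrite colE mulmxA mulmxV// mul1mx mulmx0.
  by move/matrixP/(_ k 0); rewrite !mxE !eqxx => /eqP; rewrite oner_eq0.
have arg x : x \in G -> diagonalizable_for P (rG x) -> exists a : 'I_n.+1 -> R,
    forall k, 0 <= a k < 1 /\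
      rG x *m col k (invmx P) = e2pi (a k)%:C *: col k (invmx P).
  move=> xG /eig[d Ed].
  suff /choice[a Ea] : forall k, exists b : R, 0 <= b < 1 /\ d k = e2pi b%:C.
    by exists a => k; have [? <-] := Ea k.
  move=> k; apply: (@e2pi_onto_roots #[x]%g) => //.
  have Xd m : rG x ^+ m *m col k (invmx P) = d k ^+ m *: col k (invmx P).
    elim: m => [|m IH]; first by rewrite !expr0 mul1mx scale1r.
    by rewrite exprSr -mulmxE -mulmxA Ed -scalemxAr IH scalerA -exprS.
  have := Xd #[x]%g; rewrite finX// mul1mx => /eqP.
  rewrite -subr_eq0 -{1}[col k _]scale1r -scalerBl scaler_eq0.
  by rewrite (negPf (colN0 k)) orbF subr_eq0 => /eqP.
have [[a Ea] [b Eb]] := (arg _ gG Dg, arg _ hG Dh).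
have [d Ed] := eig _ Dt.
have /choice[v Ev] : forall k, exists v : nat, forall t : R[i], t != 0 ->
    torus w t *m col k (invmx P) = t ^+ v *: col k (invmx P).
  move=> k; have /cV0Pn[i0 ci0] := colN0 k.
  exists (w i0) => t _; apply/matrixP => i j; rewrite ord1 mul_diag_mx.
  have Ei i' : (2 ^+ w i' - d k) * (col k (invmx P)) i' 0 = 0.
    have /matrixP/(_ i' 0) := Ed k; rewrite mul_diag_mx !mxE => E.
    by rewrite mulrBl E subrr.
  have dk : d k = 2 ^+ w i0.
    by apply/eqP; move/eqP: (Ei i0); rewrite mulf_eq0 (negPf ci0) orbF subr_eq0 eq_sym.
  move: (Ei i) => /eqP; rewrite dk mulf_eq0 => /orP[|/eqP]; last first.
    by rewrite !mxE => ->; rewrite !mulr0.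
  rewrite subr_eq0 -!natrX eqr_nat eqn_exp2l// => /eqP ww.
  by rewrite !mxE ww.
exists (Eigenlines (invmx P) a b v); split; first by rewrite unitmx_inv.
by move=> k /=; have [[? ?] [? ?]] := (Ea k, Eb k); split=> //; exact: Ev.
Qed.

End Existence.

(* Main.v *)
Require Import Defs.
From mathcomp Require Import ring lra zify.
Import Order.TTheory GRing.Theory Num.Theory.
Import numFieldNormedType.Exports.
Import Normc.

Local Open Scope classical_set_scope.
Local Open Scope ring_scope.
Local Open Scope complex_scope.

(** Each summand is a product over common eigenlines, and two facts give the
    theorem: the limit of one factor, and the independence of the product of
    limits from the chosen eigenlines.

    _The limit of a factor._  Put [A = e2pi X].  Up to a prefactor which is the
    same for all [X], [theta X tau] is
      [e2pi (X / 2) * (1 - A^-1) * prod_l (1 - q^l A) (1 - q^l A^-1)].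
    At [X = c - b * tau] with [0 <= b < 1], both [q * A] and [q * A^-1] are of
    the form [e2pi (c' + k * tau)] with [k > 0], so they tend to 0, and each
    infinite product tends to 1 because it differs from 1 by at most four times
    the norm of its first term ([qpoch_near1]).  Moreover [A^-1] tends to 0 if
    [b > 0] and is constant if [b = 0].  In the quotient of two theta values the
    prefactors cancel and the half-exponentials leave [y^(-1/2)]; this gives
    [line_limit_cvg].  Genericity of [z] keeps the limit of the denominator away
    from zero when [b = 0].

    _The sum over commuting pairs._  The limit of the [(g, h)] summand is
    [age_factor h * invariant_part g^-1 h]: the inverse appears because the
    limit involves [e2pi (- X)] ([sector_limitE]).  Two splittings of the same
    commuting pair into common eigenlines agree up to a permutation: the change
    of basis is invertible, so some term of its Leibniz expansion is nonzero, and
    a nonzero entry forces equal eigenvalues ([common_eigenlines_unique]).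
    Hence products over the lines may be computed on any splitting.  This lets
    [g] be replaced by [1] in the age factor, by [g^-1] in the sum over the
    centralizer, and the pair by a conjugate pair, because [rho] commutes with
    the torus.  The inner sum over [g] is then a class function of [h], and the
    class equation turns the average over the group into the sum over conjugacy
    classes.  In the abelian case no inversion is made, which explains why that
    formula has [y^u] where the general one has [y^(-u)]
    ([invariant_factorV]). *)

(** * The exponential [e2pi] *)

Section ComplexExponential.
Context {R : realType}.
Implicit Types x y z c : R[i].

Lemma cexpD x y : cexp (x + y) = cexp x * cexp y.
Proof.
case: x y => [a b] [c d]; rewrite /cexp /= expRD cosD sinD.
by apply/eqP; rewrite eq_complex /=; apply/andP; split; apply/eqP; ring.
Qed.

Lemma e2piD x y : e2pi (x + y) = e2pi x * e2pi y.
Proof. by rewrite /e2pi mulrDr cexpD. Qed.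

Lemma e2pi0 : e2pi 0 = 1 :> R[i].
Proof. by rewrite /e2pi mulr0 /cexp /= expR0 cos0 sin0 mul1r. Qed.

Lemma e2piNM x : e2pi (- x) * e2pi x = 1.
Proof. by rewrite -e2piD addNr e2pi0. Qed.

Lemma e2pi_neq0 x : e2pi x != 0.
Proof.
by apply/eqP => x0; have /eqP := e2piNM x; rewrite x0 mulr0 eq_sym oner_eq0.
Qed.

Lemma e2piN x : e2pi (- x) = (e2pi x)^-1.
Proof. by apply: (mulIf (e2pi_neq0 x)); rewrite e2piNM mulVf// e2pi_neq0. Qed.

Lemma e2pi_sum (I : Type) (r : seq I) (P : pred I) (F : I -> R[i]) :
  e2pi (\sum_(i <- r | P i) F i) = \prod_(i <- r | P i) e2pi (F i).
Proof. exact: (big_morph _ e2piD e2pi0). Qed.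

Lemma normc_e2pi x : normc (e2pi x) = expR (- (2 * pi * complex.Im x)).
Proof.
case: x => a b; rewrite /e2pi /cexp; simpc => /=.
rewrite !exprMn -mulrDr cos2Dsin2 mulr1 sqrtr_sqr ger0_norm ?expR_ge0//.
Qed.

(** Factoring out one exponential isolates the factor [1 - e2pi (- x)], which has
    a limit even when the sine itself grows. *)
Lemma csin_pi x :
  csin (pi%:C * x) = (2 * 'i)^-1 * e2pi (x / 2) * (1 - e2pi (- x)).
Proof.
rewrite /csin mulrC -mulrA; congr (_ * _).
have h y : cexp ('i * (pi%:C * y)) = e2pi (y / 2).
  by rewrite /e2pi; congr cexp; field.
have -> : - ('i * (pi%:C * x)) = 'i * (pi%:C * - x) :> R[i] by ring.
rewrite !h mulrBr mulr1 -e2piD; congr (_ - e2pi _).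
by field.
Qed.

Lemma e2pi1 : e2pi 1 = 1 :> R[i].
Proof.
rewrite -[1]/(1%:C) e2pi_real mulr1 mulr2n cosDpi sinDpi cospi sinpi.
by apply/eqP; rewrite eq_complex /=; apply/andP; split; apply/eqP; ring.
Qed.

Lemma e2pi_int (m : int) : e2pi m%:~R = 1 :> R[i].
Proof.
have nat_case (k : nat) : e2pi k%:R = 1 :> R[i].
  by elim: k => [|k IH]; rewrite ?e2pi0// -natr1 e2piD IH e2pi1 mulr1.
by case: m => k; rewrite ?NegzE ?mulrNz ?e2piN -pmulrn nat_case ?invr1.
Qed.

(** The norm forces the imaginary part to vanish; then the fractional part [r]
    satisfies [cos (2 pi r) = 1], that is [sin (pi r) = 0], with [0 <= r < 1]. *)
Lemma e2pi_eq1 x : e2pi x = 1 -> exists m : int, x = m%:~R.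
Proof.
case: x => a b e1.
have b0 : b = 0.
  have /expR_inj/eqP : expR (- (2 * pi * b)) = expR 0 :> R.
    by rewrite expR0 -[RHS](normc1 R) -e1 normc_e2pi.
  have pp : 0 < 2 * pi :> R by rewrite mulr_gt0 ?pi_gt0.
  by rewrite oppr_eq0 mulf_eq0 (gt_eqF pp) => /eqP.
subst b; exists (Num.floor a).
set m := Num.floor a; pose r := a - m%:~R.
have /andP[r0 r1] : 0 <= r < 1.
  by rewrite subr_ge0 ltrBlDl; have := floor_itv a; rewrite intrD.
have am : a +i* 0 = r%:C + m%:~R :> R[i].
  by rewrite -[m%:~R](rmorph_int (real_complex R)) -rmorphD /= subrK.
suff r00 : r = 0 by rewrite am r00 add0r.
apply/eqP; move: r0; rewrite le_eqVlt eq_sym => /orP[//|r0].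
have t0 : 0 < sin (pi * r).
  by apply: sin_gt0_pi; rewrite mulr_gt0 ?pi_gt0// gtr_pMr ?pi_gt0.
have : complex.Re (e2pi r%:C) = 1.
  by rewrite -[e2pi _]mulr1 -(e2pi_int m) -e2piD -am e1.
rewrite e2pi_real /=.
have -> : pi *+ 2 * r = pi * r + pi * r by ring.
have := cos2Dsin2 (pi * r); rewrite cosD; nra.
Qed.

Lemma e2pi_real_inj (a b : R) : 0 <= a < 1 -> 0 <= b < 1 ->
  e2pi a%:C = e2pi b%:C -> a = b.
Proof.
move=> /andP[a0 a1] /andP[b0 b1] ab.
have [m] : exists m : int, (a - b)%:C = m%:~R.
  by apply: e2pi_eq1; rewrite rmorphB e2piD e2piN ab mulfV// e2pi_neq0.
rewrite -(rmorph_int (real_complex R)) => /complexI abm.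
have lt1 : a - b < 1 by lra.
have gtN1 : -1 < a - b by lra.
move: lt1 gtN1; rewrite abm -[-1]/((-1)%:~R) -[1]/(1%:~R) !ltr_int => m1 mN1.
have m0 : m = 0 by lia.
by move: abm; rewrite m0; lra.
Qed.
End ComplexExponential.

(** * Limits of complex sequences and functions *)

Section ComplexLimits.
Context {R : realType}.
Implicit Types x y z c : R[i].

Lemma normc_triangle x y : normc (x + y) <= normc x + normc y.
Proof. exact: le_normcD. Qed.

Lemma normc_opp x : normc (- x) = normc x.
Proof. exact: normcN. Qed.

Lemma normc_ge0 x : 0 <= normc x.
Proof. by case: x => a b; exact: sqrtr_ge0. Qed.

Lemma le_Re_normc x : `|complex.Re x| <= normc x.
Proof.
by case: x => a b /=; rewrite -sqrtr_sqr ler_wsqrtr// lerDl sqr_ge0.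
Qed.

Lemma le_Im_normc x : `|complex.Im x| <= normc x.
Proof.
by case: x => a b /=; rewrite -sqrtr_sqr ler_wsqrtr// lerDr sqr_ge0.
Qed.

Lemma normc_le_ReIm x : normc x <= `|complex.Re x| + `|complex.Im x|.
Proof.
case: x => a b /=; rewrite -[leRHS]ger0_norm ?addr_ge0// -sqrtr_sqr.
apply: ler_wsqrtr; rewrite sqrrD !real_normK ?num_real// lerD2r lerDl.
by rewrite mulrn_wge0 ?mulr_ge0.
Qed.

Lemma normCE x : `|x| = (normc x)%:C.
Proof. by []. Qed.

(** The norm of [R[i]] takes its values in [R[i]]; this and the next lemma reduce
    limits in [R[i]] to limits in [R]. *)
Lemma cvg_normcP {T : Type} {F : set_system T} {FF : Filter F}
    (f : T -> R[i]^o) (l : R[i]^o) :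
  (f t @[t --> F] --> l) <-> (normc (f t - l) @[t --> F] --> (0 : R)).
Proof.
split=> [/cvgrPdist_lt fl|/(@cvgr0Pnorm_lt R R) fl].
  apply/(@cvgr0Pnorm_lt R R) => e e0.
  have := fl e%:C; rewrite -[0]/(0%:C) ltcR => /(_ e0).
  by apply: filterS => t; rewrite distrC normCE ltcR ger0_norm ?normc_ge0.
apply/cvgrPdist_lt => -[e e']; rewrite ltcE /= => /andP[/eqP-> e0].
by apply: filterS (fl e e0) => t; rewrite distrC normCE ltcR ger0_norm ?normc_ge0.
Qed.

Lemma cvg_le_normc {T : Type} {F : set_system T} {FF : Filter F}
    (f : T -> R[i]^o) (l : R[i]^o) (e : T -> R) :
  (\forall t \near F, normc (f t - l) <= e t) -> e t @[t --> F] --> 0 ->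
  f t @[t --> F] --> l.
Proof.
move=> fe e0; apply/cvg_normcP.
apply: (squeeze_cvgr _ (cvg_cst 0) e0).
by apply: filterS fe => t ->; rewrite normc_ge0.
Qed.

Lemma cvg_bounded_variation (x : R ^nat) (K : R) :
  (forall N, \sum_(0 <= l < N) `|x l.+1 - x l| <= K) -> cvgn x.
Proof.
move=> xK.
have ct : cvgn (series (telescope x)).
  apply: normed_cvg; apply: nondecreasing_is_cvgn.
    by apply: nondecreasing_series => l _ _; exact: normr_ge0.
  by exists K => _ [N _ <-]; exact: xK.
have -> : x = fun N => x 0%N + series (telescope x) N.
  by apply/funext => N; exact: eq_sum_telescope.
by apply: is_cvgD => //; exact: is_cvg_cst.
Qed.

(** Completeness of the complex numbers, in the only form used: it is inherited
    from the real and imaginary parts. *)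
Lemma cvg_complex_bounded_variation (u : nat -> R[i]^o) (K : R) :
  (forall N, \sum_(0 <= l < N) normc (u l.+1 - u l) <= K) ->
  exists p : R[i], u N @[N --> \oo] --> (p : R[i]^o).
Proof.
move=> uK.
have cRe : cvgn (fun N => complex.Re (u N)).
  apply: (@cvg_bounded_variation _ K) => N; apply: le_trans (uK N).
  by apply: ler_sum => l _; apply: le_trans (le_Re_normc _); rewrite raddfB.
have cIm : cvgn (fun N => complex.Im (u N)).
  apply: (@cvg_bounded_variation _ K) => N; apply: le_trans (uK N).
  by apply: ler_sum => l _; apply: le_trans (le_Im_normc _); rewrite raddfB.
set a := limn _ in cRe; set b := limn _ in cIm.
exists (a +i* b); apply: (@cvg_le_normc _ _ _ _ _
  (fun N => `|complex.Re (u N) - a| + `|complex.Im (u N) - b|)).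
  by apply: nearW => N; apply: le_trans (normc_le_ReIm _) _; rewrite !raddfB.
rewrite -[0]addr0; apply: cvgD; apply/norm_cvg0P.
  by rewrite -(subrr a); exact: cvgB cRe (cvg_cst _).
by rewrite -(subrr b); exact: cvgB cIm (cvg_cst _).
Qed.
End ComplexLimits.

(** * Infinite products close to 1 *)

Section InfiniteProducts.
Context {R : realType}.
Implicit Types q A : R[i].

(** While the partial sums stay below 1/2, the partial products have norm at most
    2, so each new factor moves the product by at most [2 * normc (a l)].  Hence
    they have bounded variation and stay within [2 * S] of 1. *)
Lemma cvg_prod_near1 (a : nat -> R[i]) (S : R) :
    (forall N, \sum_(0 <= l < N) normc (a l) <= S) -> S <= 1 / 2 ->
  exists2 p : R[i],
    (\prod_(0 <= l < N) (1 - a l) : R[i]^o) @[N --> \oo] --> (p : R[i]^o)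
    & normc (p - 1) <= 2 * S.
Proof.
move=> aS S2; pose P N : R[i] := \prod_(0 <= l < N) (1 - a l).
have P1 N : normc (P N - 1) <= 2 * \sum_(0 <= l < N) normc (a l).
  elim: N => [|N IH]; first by rewrite /P !big_nil subrr normc0 mulr0.
  have -> : P N.+1 - 1 = P N - 1 + - (a N + (P N - 1) * a N).
    by rewrite /P big_nat_recr//=; ring.
  apply: le_trans (normc_triangle _ _) _; rewrite normc_opp.
  have := normc_triangle (a N) ((P N - 1) * a N); rewrite normcM.
  rewrite big_nat_recr//=; have := aS N; have := normc_ge0 (a N).
  by move: (normc (P N - 1)) IH => r; nra.
have PB N : normc (P N) <= 2.
  rewrite -(subrK 1 (P N)); apply: le_trans (normc_triangle _ _) _.
  by rewrite normc1; have := P1 N; have := aS N; lra.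
have [p Pp] : exists p : R[i], (P N : R[i]^o) @[N --> \oo] --> (p : R[i]^o).
  apply: (@cvg_complex_bounded_variation _ _ (2 * S)) => N.
  apply: (@le_trans _ _ (2 * \sum_(0 <= l < N) normc (a l))); last first.
    by have := aS N; lra.
  rewrite mulr_sumr; apply: ler_sum => l _.
  have -> : P l.+1 - P l = - (P l * a l) by rewrite /P big_nat_recr//=; ring.
  by rewrite normc_opp normcM ler_wpM2r ?normc_ge0.
exists p => //; apply/ler_addgt0Pl => e e0.
move/cvg_normcP/(@cvgr0Pnorm_lt R R)/(_ _ e0) : Pp => [N _ /(_ N (leqnn N))] /=.
rewrite ger0_norm ?normc_ge0// => /ltW Ne.
have -> : p - 1 = - (P N - p) + (P N - 1) by ring.
apply: le_trans (normc_triangle _ _) _; rewrite normc_opp lerD//.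
by apply: le_trans (P1 N) _; have := aS N; lra.
Qed.

(** The q-Pochhammer symbol of [q A] with base [q]. *)
Definition qpoch q A : R[i] :=
  lim ((\prod_(1 <= l < N) (1 - q ^+ l * A) : R[i]^o) @[N --> \oo]).

(** The terms [q ^+ l * A] are dominated by a geometric series of ratio 1/2
    starting at [q * A], so their norms add up to at most [2 * normc (q * A)]. *)
Lemma qpoch_near1 q A : normc q <= 1 / 2 -> normc (q * A) <= 1 / 4 ->
  (\prod_(1 <= l < N) (1 - q ^+ l * A) : R[i]^o) @[N --> \oo]
     --> (qpoch q A : R[i]^o) /\
  normc (qpoch q A - 1) <= 4 * normc (q * A).
Proof.
move=> q2 qA4.
have normX l : normc (q ^+ l) = normc q ^+ l.
  by elim: l => [|l IH]; rewrite ?normc1// !exprS normcM IH.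
have geom N : \sum_(0 <= l < N) normc q ^+ l <= 2.
  elim: N => [|N IH]; first by rewrite big_nil.
  rewrite big_nat_recl// expr0.
  under eq_bigr do rewrite exprS.
  by rewrite -mulr_sumr; have := normc_ge0 q; nra.
have aS N : \sum_(0 <= l < N) normc (q ^+ l.+1 * A) <= 2 * normc (q * A).
  under eq_bigr do rewrite exprSr -mulrA normcM normX.
  by rewrite -mulr_suml ler_wpM2r ?normc_ge0.
have [|p pP p1] := cvg_prod_near1 _ _ aS; first by lra.
have pP1 : (\prod_(1 <= l < N) (1 - q ^+ l * A) : R[i]^o) @[N --> \oo]
    --> (p : R[i]^o).
  by rewrite -cvg_shiftS; under eq_fun do rewrite big_add1 /=.
have qp : qpoch q A = p.
  rewrite /qpoch.
  exact (@cvg_lim R[i]^o (@norm_hausdorff _ R[i]^o) nat \oo _ _ _ pP1).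
by rewrite qp; split => //; lra.
Qed.

Lemma near_qpoch {T : Type} {F : set_system T} {FF : Filter F}
    (q A : T -> R[i]) :
    normc (q t) @[t --> F] --> (0 : R) ->
    normc (q t * A t) @[t --> F] --> (0 : R) ->
  \forall t \near F,
    (\prod_(1 <= l < N) (1 - q t ^+ l * A t) : R[i]^o) @[N --> \oo]
     --> (qpoch (q t) (A t) : R[i]^o) /\
    normc (qpoch (q t) (A t) - 1) <= 4 * normc (q t * A t).
Proof.
move=> /(@cvgr0_norm_le R R)/(_ (1 / 2)) q0.
move=> /(@cvgr0_norm_le R R)/(_ (1 / 4)) A0.
have {}q0 := q0 ltac:(lra); have {}A0 := A0 ltac:(lra).
apply: filterS2 q0 A0 => t.
by rewrite !ger0_norm ?normc_ge0//; exact: qpoch_near1.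
Qed.

Lemma cvg_qpoch {T : Type} {F : set_system T} {FF : Filter F}
    (q A : T -> R[i]) :
    normc (q t) @[t --> F] --> (0 : R) ->
    normc (q t * A t) @[t --> F] --> (0 : R) ->
  (qpoch (q t) (A t) : R[i]^o) @[t --> F] --> (1 : R[i]^o).
Proof.
move=> q0 A0.
apply: (@cvg_le_normc _ _ _ _ _ _ (fun t => 4 * normc (q t * A t))).
  by apply: filterS (near_qpoch _ _ q0 A0) => t [].
by rewrite -[0](mulr0 4); exact: cvgMl_tmp.
Qed.
End InfiniteProducts.

(** * The limit of a quotient of theta values *)

Section ThetaLimit.
Context {R : realType}.
Implicit Types c d z tau X Y : R[i].

#[local] Instance ioo_filter : Filter (@ioo R) := ioo_proper_filter.

Lemma cvg_normc_e2pi_ioo c (k : R) : 0 < k ->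
  normc (e2pi (c + k%:C * tau)) @[tau --> ioo] --> (0 : R).
Proof.
move=> k0.
have Im_oo : 2 * pi * (complex.Im c + k * complex.Im tau) @[tau --> ioo] --> +oo.
  move=> A [M [_ MA]]; exists ((M / (2 * pi) - complex.Im c) / k) => tau.
  rewrite ltr_pdivrMr// ltrBlDl ltr_pdivrMr ?mulr_gt0 ?pi_gt0// => Mtau.
  by apply: MA; rewrite [X in _ < X]mulrC (mulrC k).
apply: cvg_trans (cvg_comp _ _ Im_oo (@cvgr_expR R)).
apply: near_eq_cvg; apply: nearW => tau.
rewrite normc_e2pi; case: c tau {Im_oo} => [c1 c2] [t1 t2] /=.
by congr expR; ring.
Qed.

(** What is left of [theta X tau] after removing [e2pi (X / 2)] and the factors
    independent of [X]. *)
Definition theta_core X tau : R[i] :=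
  (1 - e2pi (- X)) * (qpoch (e2pi tau) (e2pi X) * qpoch (e2pi tau) (e2pi (- X))).

Lemma nome_cvg0 : normc (e2pi tau) @[tau --> ioo] --> (0 : R).
Proof.
apply: cvg_trans (cvg_normc_e2pi_ioo 0 1 ltr01).
by apply: near_eq_cvg; apply: nearW => tau; rewrite add0r mul1r.
Qed.

(** One factor [q] absorbs the growth of [e2pi (c + k * tau)] as long as
    [k > -1]; this is where [b < 1] is used. *)
Lemma nome_mul_cvg0 c (k : R) : -1 < k ->
  normc (e2pi tau * e2pi (c + k%:C * tau)) @[tau --> ioo] --> (0 : R).
Proof.
move=> k1; have k0 : 0 < 1 + k by lra.
apply: cvg_trans (cvg_normc_e2pi_ioo c _ k0).
apply: near_eq_cvg; apply: nearW => tau; rewrite -e2piD.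
by congr (normc (e2pi _)); rewrite rmorphD rmorph1; ring.
Qed.

Section Core.
Variables (c : R[i]) (b : R).
Hypothesis b01 : 0 <= b < 1.
Let X tau := c - b%:C * tau.

Let XE tau : X tau = c + (- b)%:C * tau.
Proof. by rewrite rmorphN /X mulNr. Qed.

Let XNE tau : - X tau = - c + b%:C * tau.
Proof. by rewrite /X; ring. Qed.

Let qX0 : normc (e2pi tau * e2pi (X tau)) @[tau --> ioo] --> (0 : R).
Proof.
have bN : -1 < - b by move: b01 => /andP[]; lra.
apply: cvg_trans (nome_mul_cvg0 c _ bN).
by apply: near_eq_cvg; apply: nearW => tau; rewrite XE.
Qed.

Let qXN0 : normc (e2pi tau * e2pi (- X tau)) @[tau --> ioo] --> (0 : R).
Proof.
have bN : -1 < b by move: b01 => /andP[]; lra.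
apply: cvg_trans (nome_mul_cvg0 (- c) _ bN).
by apply: near_eq_cvg; apply: nearW => tau; rewrite XNE.
Qed.

Lemma theta_core_cvg :
  (theta_core (c - b%:C * tau) tau : R[i]^o) @[tau --> ioo] -->
  ((if b == 0 then 1 - e2pi (- c) else 1) : R[i]^o).
Proof.
set l := (if _ then _ else _).
rewrite -[l]mulr1 -[X in l * X]mulr1.
apply: (@cvgM R[i]); last first.
  apply: (@cvgM R[i]).
    exact: (cvg_qpoch _ _ nome_cvg0 qX0).
  exact: (cvg_qpoch _ _ nome_cvg0 qXN0).
rewrite /l; have [b0|b0] := eqVneq b 0.
  rewrite (_ : (fun tau => _) = fun=> (1 - e2pi (- c) : R[i]^o)).
    by apply: cvg_cst.
  by apply/funext => tau; rewrite b0 rmorph0 mul0r subr0.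
have bgt0 : 0 < b by rewrite lt_neqAle eq_sym b0; case/andP: b01.
apply/cvg_normcP; apply: cvg_trans (cvg_normc_e2pi_ioo (- c) _ bgt0).
apply: near_eq_cvg; apply: nearW => tau.
by rewrite -XNE addrAC subrr add0r normc_opp.
Qed.

(** The equality needs the convergence of the infinite products, hence holds only
    near [ioo]: the limit of a product of sequences is split. *)
Lemma theta_near : \forall tau \near ioo,
  theta (X tau) tau =
  (e2pi (tau / 8) * 'i^-1 * qpoch (e2pi tau) 1) *
  (e2pi (X tau / 2) * theta_core (X tau) tau).
Proof.
have near1 := near_qpoch (FF := ioo_filter) _ _ nome_cvg0 qX0.
have near2 := near_qpoch (FF := ioo_filter) _ _ nome_cvg0 qXN0.
apply: (@filterS2 _ ioo ioo_filter _ _ _ _ near1 near2) => tau [h1 _] [h2 _].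
rewrite /theta.
have -> : lim ((\prod_(1 <= l < N) (1 - e2pi tau ^+ l) : R[i]^o) @[N --> \oo]) =
    qpoch (e2pi tau) 1.
  rewrite /qpoch.
  rewrite (_ : (fun N => \prod_(1 <= l < N) (1 - e2pi tau ^+ l)) =
            (fun N => \prod_(1 <= l < N) (1 - e2pi tau ^+ l * 1)))//.
  by apply/funext => N; apply: eq_bigr => l _; rewrite mulr1.
have -> : lim ((\prod_(1 <= l < N) ((1 - e2pi tau ^+ l * e2pi (X tau)) *
      (1 - e2pi tau ^+ l * e2pi (- X tau))) : R[i]^o) @[N --> \oo]) =
    qpoch (e2pi tau) (e2pi (X tau)) * qpoch (e2pi tau) (e2pi (- X tau)).
  rewrite (_ : (fun N => _) = (fun N : nat =>
    \prod_(1 <= l < N) (1 - e2pi tau ^+ l * e2pi (X tau)) *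
    \prod_(1 <= l < N) (1 - e2pi tau ^+ l * e2pi (- X tau)))).
    exact (@cvg_lim R[i]^o (@norm_hausdorff _ R[i]^o) nat \oo _ _ _
             (@cvgM R[i] _ _ _ _ _ _ _ h1 h2)).
  by apply/funext => N; rewrite big_split.
rewrite csin_pi /theta_core; field; exact: neq0Ci.
Qed.
End Core.

Lemma qpoch1_neq0_near : \forall tau \near ioo, qpoch (e2pi tau) 1 != 0 :> R[i].
Proof.
have q1 : normc (e2pi tau * 1) @[tau --> ioo] --> (0 : R).
  apply: cvg_trans nome_cvg0; apply: near_eq_cvg; apply: nearW => tau.
  by rewrite mulr1.
have /cvg_normcP := cvg_qpoch (FF := ioo_filter) _ _ nome_cvg0 q1.
move=> /(@cvgr0_norm_lt R R)/(_ _ ltr01).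
apply: (@filterS _ ioo ioo_filter) => tau; apply: contraTneq => ->.
by rewrite sub0r normc_opp normc1 normr1 ltxx.
Qed.

Lemma theta_ratio_cvg c d (b : R) : 0 <= b < 1 -> (b = 0 -> e2pi (- d) != 1) ->
  (theta (c - b%:C * tau) tau / theta (d - b%:C * tau) tau : R[i]^o)
    @[tau --> ioo] -->
  (e2pi ((c - d) / 2) *
   (if b == 0 then (1 - e2pi (- c)) / (1 - e2pi (- d)) else 1) : R[i]^o).
Proof.
move=> b01 d1.
have : (e2pi ((c - d) / 2) * (theta_core (c - b%:C * tau) tau /
    theta_core (d - b%:C * tau) tau) : R[i]^o) @[tau --> ioo] -->
  (e2pi ((c - d) / 2) * ((if b == 0 then 1 - e2pi (- c) else 1) /
    (if b == 0 then 1 - e2pi (- d) else 1)) : R[i]^o).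
  apply: (@cvgM R[i]); first exact: cvg_cst.
  apply: (@cvgM R[i]); first exact: theta_core_cvg.
  apply: (@cvgV R[i]); last exact: theta_core_cvg.
  case: (eqVneq b 0) => [/d1|_]; last exact: oner_neq0.
  by rewrite subr_eq0 eq_sym.
rewrite (_ : (if b == 0 then _ else _) / _ =
  if b == 0 then (1 - e2pi (- c)) / (1 - e2pi (- d)) else 1); last first.
  by case: eqVneq => _; rewrite ?divr1.
move=> core_cvg; apply: cvg_trans core_cvg; apply: near_eq_cvg.
apply: (@filterS3 _ ioo ioo_filter _ _ _ _ _
  (theta_near c _ b01) (theta_near d _ b01) qpoch1_neq0_near).
move=> tau -> -> q0.
rewrite -[RHS]mulf_div divff ?mul1r; last first.
  apply: mulf_neq0 => //.
  by apply: mulf_neq0; rewrite ?invr_eq0 ?neq0Ci ?e2pi_neq0.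
by rewrite -[RHS]mulf_div -e2piN -e2piD; congr (e2pi _ * _); field.
Qed.

(** The limit of the factor of a line of weight ratio [u] on which [g] acts by the
    angle [a] and [h] by the angle [b]. *)
Definition line_limit z (u : R[i]) (a b : R) : R[i] :=
  if b == 0 then
    ypow z (- (1 / 2)) * ((1 - ypow z (1 - u) * e2pi (- a%:C)) /
                          (1 - ypow z (- u) * e2pi (- a%:C)))
  else ypow z (- (1 / 2) + b%:C).

Lemma line_limit_cvg z (u v : R[i]) (a b : R) : 0 <= b < 1 ->
    v = u * z ->
    (b = 0 -> forall m : int, v + a%:C != m%:~R) ->
  (theta ((u - 1) * z + a%:C - b%:C * tau) tau /
   theta (v + a%:C - b%:C * tau) tau * e2pi (b%:C * z) : R[i]^o)
    @[tau --> ioo] --> (line_limit z u a b : R[i]^o).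
Proof.
move=> b01 -> gen.
have -> : line_limit z u a b =
  e2pi ((((u - 1) * z + a%:C) - (u * z + a%:C)) / 2) *
  (if b == 0 then (1 - e2pi (- ((u - 1) * z + a%:C))) /
    (1 - e2pi (- (u * z + a%:C))) else 1) * e2pi (b%:C * z).
  rewrite /line_limit /ypow -!e2piD; case: eqVneq => [->|_].
    rewrite mul0r e2pi0 mulr1.
    by congr (e2pi _ * ((1 - e2pi _) / (1 - e2pi _))); field.
  by rewrite mulr1 -e2piD; congr e2pi; field.
apply: (@cvgM R[i]); last exact: cvg_cst.
apply: theta_ratio_cvg => // /gen {}gen; apply/eqP => /e2pi_eq1[m].
move/eqP; rewrite eqr_oppLR -rmorphN => /eqP E.
by have := gen (- m); rewrite E eqxx.
Qed.
End ThetaLimit.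

(** * Uniqueness of common eigenlines *)

(** Some term of the Leibniz expansion is nonzero. *)
Lemma det_neq0_perm (K : fieldType) (m : nat) (M : 'M[K]_m) :
  \det M != 0 -> exists s : 'S_m, forall i, M i (s i) != 0.
Proof.
move=> detM; have /existsP[s s0] : [exists s : 'S_m, \prod_i M i (s i) != 0].
  apply: contraNT detM; rewrite negb_exists => /forallP M0.
  by apply/eqP/big1 => s _; have /negPn/eqP-> := M0 s; rewrite mulr0.
by exists s => i; move/prodf_neq0: s0; apply.
Qed.

(** If [M] is the change of basis, then [diag d * M = M * diag d']; compare
    entries. *)
Lemma eigenbasis_change (K : fieldType) (m : nat) (A P P' : 'M[K]_m)
    (d d' : 'I_m -> K) : P \in unitmx ->
    (forall k, A *m col k P = d k *: col k P) ->
    (forall k, A *m col k P' = d' k *: col k P') ->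
  forall i j, (invmx P *m P') i j != 0 -> d i = d' j.
Proof.
have diag (Q : 'M[K]_m) (e : 'I_m -> K) :
    (forall k, A *m col k Q = e k *: col k Q) ->
    A *m Q = Q *m diag_mx (\row_k e k).
  move=> Qe; apply/matrixP => i k; rewrite mul_mx_diag !mxE.
  have /matrixP/(_ i 0) := Qe k; rewrite !mxE mulrC => <-.
  by apply: eq_bigr => l _; rewrite !mxE.
move=> Pu /diag AP /diag AP' i j; set M := invmx P *m P' => M0.
have P'E : P' = P *m M by rewrite mulKVmx.
clearbody M.
have : diag_mx (\row_k d k) *m M = M *m diag_mx (\row_k d' k).
  apply: (can_inj (mulKmx Pu)).
  by rewrite mulmxA -AP -mulmxA -P'E AP' mulmxA -P'E.
move/matrixP/(_ i j); rewrite mul_diag_mx mul_mx_diag !mxE mulrC.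
exact: (mulfI M0).
Qed.

Section InverseAngle.
Context {R : realType}.

(** The representative in [0, 1) of the angle [- a]. *)
Definition inv_angle (a : R) := if a == 0 then 0 else 1 - a.

Lemma inv_angle_itv (a : R) : 0 <= a < 1 -> 0 <= inv_angle a < 1.
Proof.
rewrite /inv_angle; case: eqVneq => [_ _|a0 /andP[a_ge0 a1]]; first by lra.
have : 0 < a by rewrite lt_neqAle eq_sym a0.
by lra.
Qed.

Lemma e2pi_inv_angle (a : R) : e2pi (inv_angle a)%:C = e2pi (- a%:C).
Proof.
rewrite /inv_angle; case: eqVneq => [->|_]; first by rewrite rmorph0 oppr0.
by rewrite rmorphB rmorph1 e2piD e2pi1 mul1r.
Qed.

End InverseAngle.

Section Eigenlines.
Context {R : realType} {gT : finGroupType} {n : nat}.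
Variables (G : {group gT}) (rG : mx_representation R[i] G n) (w : 'I_n -> nat).
Implicit Types (g h x : gT) (L : eigenlines R n).

(** The permutation depends only on the change of basis, so one and the same works
    for both group elements and for the torus.  The torus is tested at [t = 2],
    whose powers are distinct. *)
Lemma common_eigenlines_unique g h L L' :
    common_eigenlines rG w g h L -> common_eigenlines rG w g h L' ->
  exists s : 'S_n, forall k, [/\ line_fst L k = line_fst L' (s k),
    line_snd L k = line_snd L' (s k) & line_weight L k = line_weight L' (s k)].
Proof.
move=> [Pu PL] [Pu' PL'].
have [s sM] := @det_neq0_perm _ _ (invmx (line_basis L) *m line_basis L') ltac:(
  by rewrite -unitfE -unitmxE unitmx_mul unitmx_inv Pu Pu').
exists s => k; have [a01 _ b01 _ _] := PL k; have [a01' _ b01' _ _] := PL' (s k).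
split.
- apply: e2pi_real_inj => //.
  by apply: (eigenbasis_change _ _ (rG g) _ _ (fun k => e2pi (line_fst L k)%:C)
    (fun k => e2pi (line_fst L' k)%:C) Pu _ _ _ _ (sM k)) => i;
    [have [] := PL i|have [] := PL' i].
- apply: e2pi_real_inj => //.
  by apply: (eigenbasis_change _ _ (rG h) _ _ (fun k => e2pi (line_snd L k)%:C)
    (fun k => e2pi (line_snd L' k)%:C) Pu _ _ _ _ (sM k)) => i;
    [have [] := PL i|have [] := PL' i].
have two0 : 2 != 0 :> R[i] by rewrite pnatr_eq0.
have /eqP : 2 ^+ line_weight L k = 2 ^+ line_weight L' (s k) :> R[i].
  by apply: (eigenbasis_change _ _ (torus w 2) _ _ (fun k => 2 ^+ line_weight L k)
    (fun k => 2 ^+ line_weight L' k) Pu _ _ _ _ (sM k)) => i;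
    [have [_ _ _ _ ->] := PL i|have [_ _ _ _ ->] := PL' i].
by rewrite -!natrX eqr_nat eqn_exp2l// => /eqP.
Qed.

(** The form in which uniqueness is used: a product or a sum over the lines of
    expressions in their angles and weights depends only on the pair [(g, h)]. *)
Lemma common_eigenlines_bigop (T : Type) (idx : T) (op : Monoid.com_law idx)
    (P : R -> R -> nat -> bool) (F : R -> R -> nat -> T) g h L L' :
    common_eigenlines rG w g h L -> common_eigenlines rG w g h L' ->
  \big[op/idx]_(k < n | P (line_fst L k) (line_snd L k) (line_weight L k))
     F (line_fst L k) (line_snd L k) (line_weight L k) =
  \big[op/idx]_(k < n | P (line_fst L' k) (line_snd L' k) (line_weight L' k))
     F (line_fst L' k) (line_snd L' k) (line_weight L' k).
Proof.
move=> CL CL'; have [s sE] := common_eigenlines_unique _ _ _ _ CL CL'.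
rewrite [RHS](reindex_inj (@perm_inj _ s)).
by apply: eq_big => [k|k _]; have [-> -> ->] := sE k.
Qed.

Definition eigenlines_trivial_fst L :=
  Eigenlines (line_basis L) (fun=> 0) (line_snd L) (line_weight L).

Lemma common_eigenlines1 g h L : common_eigenlines rG w g h L ->
  common_eigenlines rG w 1%g h (eigenlines_trivial_fst L).
Proof.
move=> [Pu PL]; split=> //= k; have [_ _ ? ? ?] := PL k; split=> //.
  by rewrite lexx ltr01.
by rewrite repr_mx1 mul1mx e2pi0 scale1r.
Qed.

Definition eigenlines_inv_fst L :=
  Eigenlines (line_basis L) (fun k => inv_angle (line_fst L k))
    (line_snd L) (line_weight L).

Lemma common_eigenlines_inv g h L : g \in G -> common_eigenlines rG w g h L ->
  common_eigenlines rG w g^-1%g h (eigenlines_inv_fst L).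
Proof.
move=> gG [Pu PL]; split=> //= k; have [a01 gE ? ? ?] := PL k.
split=> //; first exact: inv_angle_itv.
rewrite e2pi_inv_angle; move/(congr1 (mulmx (rG g^-1%g))): gE.
rewrite mulmxA -repr_mxM ?groupV// mulVg repr_mx1 mul1mx -scalemxAr => /esym E.
rewrite -[X in _ = _ *: X]E scalerA -e2piD addNr e2pi0 scale1r //.
Qed.

Definition eigenlines_conj x L :=
  Eigenlines (rG x^-1%g *m line_basis L) (line_fst L) (line_snd L)
    (line_weight L).

Hypothesis rG_torus : forall g (t : R[i]), g \in G -> t != 0 ->
  rG g *m torus w t = torus w t *m rG g.

Lemma common_eigenlines_conj x g h L : x \in G -> g \in G -> h \in G ->
    common_eigenlines rG w g h L ->
  common_eigenlines rG w (g ^ x)%g (h ^ x)%g (eigenlines_conj x L).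
Proof.
move=> xG gG hG [Pu PL]; have xVG : (x^-1)%g \in G by rewrite groupV.
have colM k : col k (rG x^-1%g *m line_basis L) = rG x^-1%g *m col k (line_basis L).
  by rewrite !colE mulmxA.
have conjE y k : y \in G -> rG (y ^ x)%g *m (rG x^-1%g *m col k (line_basis L)) =
    rG x^-1%g *m (rG y *m col k (line_basis L)).
  move=> yG; rewrite !mulmxA -!repr_mxM ?groupJ//.
  by congr (rG _ *m _); rewrite conjgE !mulgA mulgK.
split=> [|k] /=; first by rewrite unitmx_mul Pu repr_mx_unit.
have [? gE ? hE tE] := PL k; rewrite colM !conjE// gE hE -!scalemxAr.
split=> // t t0; rewrite mulmxA -rG_torus// -mulmxA tE// -scalemxAr //.
Qed.
End Eigenlines.

(** * Summation over commuting pairs *)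

Section OrbifoldSums.
Context {R : realType} {gT : finGroupType} {n : nat}.
Variables (G : {group gT}) (rG : mx_representation R[i] G n).
Variables (w : 'I_n -> nat) (D : nat) (L : gT -> gT -> eigenlines R n) (z : R[i]).
Hypothesis rG_torus : forall g (t : R[i]), g \in G -> t != 0 ->
  rG g *m torus w t = torus w t *m rG g.
Hypothesis L_lines : forall g h, g \in G -> h \in G -> commute g h ->
  common_eigenlines rG w g h (L g h).

(** The exponent is the age of [h] shifted by half the number of lines that [h]
    moves. *)
Definition age_factor (h : gT) : R[i] :=
  ypow z (\sum_(k < n | line_snd (L 1%g h) k != 0)
    (- (1 / 2) + (line_snd (L 1%g h) k)%:C)).

Definition invariant_factor (u zeta : R[i]) : R[i] :=
  ypow z (- (1 / 2)) * ((1 - ypow z (1 - u) * zeta) / (1 - ypow z (- u) * zeta)).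

(** Multiply the numerator and the denominator by [- y^(-u) * e2pi (- a)]. *)
Lemma invariant_factorV (u : R[i]) (a : R) :
  invariant_factor u (e2pi (- a%:C)) =
  (ypow z (1 / 2) - ypow z (u - 1 / 2) * e2pi a%:C) / (1 - ypow z u * e2pi a%:C).
Proof.
rewrite /invariant_factor /ypow.
pose t := e2pi (- (u * z + a%:C)); have t0 : t != 0 := e2pi_neq0 _.
have -> : e2pi (1 / 2 * z) - e2pi ((u - 1 / 2) * z) * e2pi a%:C =
  (- t)^-1 * (e2pi (- (1 / 2) * z) * (1 - e2pi ((1 - u) * z) * e2pi (- a%:C))).
  apply: (mulfI (_ : - t != 0)); first by rewrite oppr_eq0.
  rewrite mulVKf ?oppr_eq0// mulNr !mulrBr mulr1 /t -!e2piD opprB.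
  by congr (e2pi _ - e2pi _); field.
have -> : 1 - e2pi (u * z) * e2pi a%:C =
  (- t)^-1 * (1 - e2pi (- u * z) * e2pi (- a%:C)).
  apply: (mulfI (_ : - t != 0)); first by rewrite oppr_eq0.
  rewrite mulVKf ?oppr_eq0// mulNr !mulrBr mulr1 /t -!e2piD opprB.
  by rewrite -e2pi0; congr (e2pi _ - e2pi _); ring.
by rewrite -mulf_div divff ?mul1r ?mulrA// invr_eq0 oppr_eq0.
Qed.

Definition invariant_part (g h : gT) : R[i] :=
  \prod_(k < n | line_snd (L g h) k == 0)
    invariant_factor ((line_weight (L g h) k)%:R / D%:R)
      (e2pi (line_fst (L g h) k)%:C).

(** The limit of the [(g, h)] summand of the elliptic genus. *)
Definition sector_limit (g h : gT) : R[i] :=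
  \prod_(k < n) line_limit z ((line_weight (L g h) k)%:R / D%:R)
    (line_fst (L g h) k) (line_snd (L g h) k).

(** The age factor is defined with the lines of the pair [(1, h)], but any
    splitting adapted to [(g, h)] is also one for [(1, h)]. *)
Lemma age_factorE g h : g \in G -> h \in G -> commute g h ->
  age_factor h = \prod_(k < n | line_snd (L g h) k != 0)
    ypow z (- (1 / 2) + (line_snd (L g h) k)%:C).
Proof.
move=> gG hG gh; have c1 : commute 1%g h by exact: (commute_sym (commute1 _)).
rewrite /age_factor /ypow mulr_suml e2pi_sum.
exact: (common_eigenlines_bigop _ _ _ _ _ _ (fun _ b _ => b != 0)
  (fun _ b _ => e2pi ((- (1 / 2) + b%:C) * z)) _ _ _ _
  (L_lines _ _ (group1 G) hG c1)
  (common_eigenlines1 _ _ _ _ _ _ (L_lines _ _ gG hG gh))).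
Qed.

Lemma invariant_partV g h : g \in G -> h \in G -> commute g h ->
  invariant_part g^-1 h = \prod_(k < n | line_snd (L g h) k == 0)
    invariant_factor ((line_weight (L g h) k)%:R / D%:R)
      (e2pi (- (line_fst (L g h) k)%:C)).
Proof.
move=> gG hG gh; have gVh : commute g^-1%g h.
  by apply/commute_sym/commuteV/commute_sym.
have gVG : (g^-1)%g \in G by rewrite groupV.
rewrite /invariant_part.
rewrite (common_eigenlines_bigop _ _ _ _ _ _ (fun _ b _ => b == 0)
  (fun a _ wt => invariant_factor (wt%:R / D%:R) (e2pi a%:C)) _ _ _ _
  (L_lines _ _ gVG hG gVh)
  (common_eigenlines_inv _ _ _ _ _ _ gG (L_lines _ _ gG hG gh))) /=.
by apply: eq_bigr => k _; rewrite e2pi_inv_angle.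
Qed.

Lemma sector_limitE g h : g \in G -> h \in G -> commute g h ->
  sector_limit g h = age_factor h * invariant_part g^-1 h.
Proof.
move=> gG hG gh; rewrite (age_factorE _ _ gG hG gh) invariant_partV//.
rewrite /sector_limit (bigID (fun k => line_snd (L g h) k == 0)) /= mulrC.
by congr (_ * _); apply: eq_bigr => k b0; rewrite /line_limit ?(negPf b0) ?b0.
Qed.

Lemma age_factorJ h x : x \in G -> h \in G ->
  age_factor (h ^ x) = age_factor h.
Proof.
move=> xG hG; have hxG : (h ^ x)%g \in G by rewrite groupJ.
have c1 (y : gT) : commute 1%g y by exact: (commute_sym (commute1 _)).
have CJ := common_eigenlines_conj _ _ _ rG_torus _ _ _ _ xG (group1 G) hG
  (L_lines _ _ (group1 G) hG (c1 h)).
rewrite conj1g in CJ.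
rewrite /age_factor /ypow !mulr_suml !e2pi_sum.
exact: (common_eigenlines_bigop _ _ _ _ _ _ (fun _ b _ => b != 0)
  (fun _ b _ => e2pi ((- (1 / 2) + b%:C) * z)) _ _ _ _
  (L_lines _ _ (group1 G) hxG (c1 _)) CJ).
Qed.

Lemma invariant_partJ g h x : x \in G -> g \in G -> h \in G -> commute g h ->
  invariant_part (g ^ x) (h ^ x) = invariant_part g h.
Proof.
move=> xG gG hG gh.
have hxG : (h ^ x)%g \in G by rewrite groupJ.
have gxG : (g ^ x)%g \in G by rewrite groupJ.
have ghx : commute (g ^ x)%g (h ^ x)%g by rewrite /commute -!conjMg gh.
exact: (common_eigenlines_bigop _ _ _ _ _ _ (fun _ b _ => b == 0)
  (fun a _ wt => invariant_factor (wt%:R / D%:R) (e2pi a%:C)) _ _ _ _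
  (L_lines _ _ gxG hxG ghx)
  (common_eigenlines_conj _ _ _ rG_torus _ _ _ _ xG gG hG (L_lines _ _ gG hG gh))).
Qed.

Lemma cent1_commute g h : g \in 'C_G[h]%g -> g \in G /\ commute g h.
Proof. by case/setIP => gG /cent1P/commute_sym. Qed.

Definition sector_sum (h : gT) : R[i] :=
  age_factor h * \sum_(g in 'C_G[h]%g) invariant_part g h.

Lemma sector_sumJ h x : x \in G -> h \in G ->
  sector_sum (h ^ x) = sector_sum h.
Proof.
move=> xG hG; rewrite /sector_sum age_factorJ//; congr (_ * _).
have memC g : ((g ^ x)%g \in 'C_G[(h ^ x)%g]%g) = (g \in 'C_G[h]%g).
  by rewrite !finset.in_setI groupJr// cent1J memJ_conjg.
rewrite (reindex_inj (conjg_inj x)); apply: eq_big => [g|g]; rewrite memC //.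
by move/cent1_commute => [gG gh]; exact: invariant_partJ.
Qed.

(** The sum over [g] in the centralizer of [h] is invariant under [g -> g^-1],
    which removes the inverse of [sector_limitE]. *)
Lemma sum_sector_limit :
  \sum_(g in G) \sum_(h in G | (g * h == h * g)%g) sector_limit g h =
  \sum_(h in G) sector_sum h.
Proof.
rewrite (exchange_big_dep (mem G)) /=; last by move=> g h _ /andP[].
apply: eq_bigr => h hG; rewrite /sector_sum mulr_sumr.
rewrite [RHS](reindex_inj invg_inj) /=.
apply: eq_big => [g|g /andP[gG /andP[_ /eqP gh]]].
  by rewrite groupV hG inE; congr (_ && _); rewrite -(sameP cent1P eqP) cent1C.
exact: sector_limitE.
Qed.

(** Class equation: the class of [h] has [#|G : 'C_G[h]|] elements. *)
Lemma sum_classes_rep (F : gT -> R[i]) (rep : {set gT} -> gT) :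
    (forall x h, x \in G -> h \in G -> F (h ^ x)%g = F h) ->
    (forall c, c \in classes G -> rep c \in c) ->
  #|G|%:R^-1 * \sum_(h in G) F h =
  \sum_(c in classes G) #|'C_G[rep c]%g|%:R^-1 * F (rep c).
Proof.
move=> FJ repc; have G0 : #|G|%:R != 0 :> R[i] by rewrite pnatr_eq0 -lt0n.
rewrite sum_by_classes => [|h x hG xG]; last exact: FJ.
rewrite mulr_sumr; apply: eq_bigr => c cG.
have [h hG cE] := imsetP cG.
have rc := repc c cG; have rG' : rep c \in G.
  by move: rc; rewrite cE => /imsetP[x xG ->]; rewrite groupJ.
have cE' : c = (rep c ^: G)%g.
  by move: rc; rewrite cE => /class_eqP ->.
have : repr c \in (rep c ^: G)%g by rewrite -cE'; exact: mem_repr rc.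
case/imsetP => x xG ->; rewrite FJ//; rewrite mulrA; congr (_ * _).
rewrite {1}cE' -index_cent1.
have C0 : #|'C_G[rep c]%g|%:R != 0 :> R[i] by rewrite pnatr_eq0 -lt0n.
apply: (mulfI G0); rewrite mulrA divff// mul1r; apply: (mulIf C0).
by rewrite divfK// -natrM mulnC Lagrange// subsetIl.
Qed.

Lemma LG_elliptic_genus_cvg : generic_point G D L z ->
  (LG_elliptic_genus G D L z tau : R[i]^o) @[tau --> ioo] -->
  (#|G|%:R^-1 * \sum_(g in G) \sum_(h in G | (g * h == h * g)%g)
     sector_limit g h : R[i]^o).
Proof.
move=> gen; apply: (@cvgM R[i]); first exact: cvg_cst.
apply: (@cvg_big R[i]^o); first exact: add_continuous.
move=> g gG; apply: (@cvg_big R[i]^o); first exact: add_continuous.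
move=> h /andP[hG /eqP gh].
apply: (@cvg_big R[i]^o); first exact: (@mul_continuous R[i]).
move=> k _; have [_ /(_ k)[_ _ b01 _ _]] := L_lines _ _ gG hG gh.
apply: line_limit_cvg => //; first by rewrite mulrAC.
by move=> b0 m; apply: (gen g h k m).
Qed.

End OrbifoldSums.

(** * The limit of the elliptic genus *)

Theorem proposition6p9 (R : realType) (n D : nat) (w : 'I_n -> nat)
    (gT : finGroupType) (Delta : {group gT})
    (rho : mx_representation R[i] Delta n)
    (L : gT -> gT -> eigenlines R n) (rep : {set gT} -> gT) (z : R[i])
    (D_gt0 : (0 < D)%N) (w_gt0 : forall j, (0 < w j)%N)
    (rho_inj : mx_faithful rho)
    (rho_SL : forall g, g \in Delta -> \det (rho g) = 1)
    (rho_torus : forall g (t : R[i]), g \in Delta -> t != 0 ->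
       rho g *m torus w t = torus w t *m rho g)
    (J_central : exists2 J, J \in 'Z(Delta)%g & rho J = grading_operator w D)
    (L_lines : forall g h, g \in Delta -> h \in Delta -> commute g h ->
       common_eigenlines rho w g h (L g h))
    (rep_class : forall c, c \in classes Delta -> rep c \in c)
    (z_generic : generic_point Delta D L z) :
  let y := ypow z in
  let genus0 : R[i] :=
    \sum_(c in classes Delta)
      let h := rep c in
      y (\sum_(k < n | line_snd (L 1%g h) k != 0)
           (- (1 / 2) + (line_snd (L 1%g h) k)%:C)) *
      (#|'C_Delta[h]%g|%:R^-1 *
       \sum_(g in 'C_Delta[h]%g) \prod_(k < n | line_snd (L g h) k == 0)
         let u : R[i] := (line_weight (L g h) k)%:R / D%:R in
         let zeta := e2pi (line_fst (L g h) k)%:C in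
         y (- (1 / 2)) * ((1 - y (1 - u) * zeta) / (1 - y (- u) * zeta))) in
  ((LG_elliptic_genus Delta D L z tau : R[i]^o) @[tau --> ioo]
     --> (genus0 : R[i]^o)) /\
  (abelian Delta ->
   genus0 =
     #|Delta|%:R^-1 *
     \sum_(h in Delta)
       y (\sum_(k < n | line_snd (L 1%g h) k != 0)
            (- (1 / 2) + (line_snd (L 1%g h) k)%:C)) *
       \sum_(g in Delta) \prod_(k < n | line_snd (L g h) k == 0)
         let u : R[i] := (line_weight (L g h) k)%:R / D%:R in
         let zeta := e2pi (line_fst (L g h) k)%:C in
         (y (1 / 2) - y (u - 1 / 2) * zeta) / (1 - y u * zeta)).
Proof.
move=> y genus0.
have genus0E : genus0 = #|Delta|%:R^-1 * \sum_(h in Delta) sector_sum Delta D L z h.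
  rewrite (sum_classes_rep _ _ rep)//; last first.
    by move=> x h xG hG; exact: (sector_sumJ _ _ _ _ _ _ rho_torus L_lines).
  apply: eq_bigr => c _; rewrite /sector_sum mulrCA; congr (_ * _).
split=> [|abG].
  rewrite genus0E -(sum_sector_limit _ _ _ _ _ _ L_lines).
  exact: (LG_elliptic_genus_cvg _ _ _ _ _ _ L_lines).
rewrite genus0E; congr (_ * _); apply: eq_bigr => h hG.
rewrite /sector_sum; congr (_ * _).
have -> : 'C_Delta[h]%g = Delta.
  by apply/finset.setIidPl; rewrite sub_cent1 (fintype.subsetP abG).
rewrite (reindex_inj invg_inj) /=.
apply: eq_big => [g|g]; rewrite groupV// => gG.
rewrite (invariant_partV _ _ _ _ _ _ L_lines) //; last exact: (centsP abG).
by apply: eq_bigr => k _; rewrite invariant_factorV.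
Qed.
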